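(* Let $\kappa$ be a cardinal with $2 \leq \kappa \leq \mathfrak{c}^+$, where $\mathfrak{c} = 2^{\aleph_0}$ and $\mathfrak{c}^+$ is its successor cardinal. Then there exists a branchwise-real tree which is uniformly $\kappa$-branching, rigid, and continuously gradable.
   Context: Let $X$ be a partial order. A branch of $X$ is a maximal chain (linearly ordered subset). A tree order is a partial order $X$ such that (1) for every $x \in X$ the set $\{y \in X \mid y \leq x\}$ is linearly ordered, and (2) $X$ has a minimum element, its root. A branchwise-real tree is a tree order $X$ such that (a) every branch of $X$ is order-isomorphic to a real interval, and (b) for any $x,y \in X$ the set $\{z \in X \mid z \leq x \text{ and } z \leq y\}$ has a maximum element. For $x$ in a tree order $X$, a component above $x$ is an equivalence class of $\{y \in X \mid y > x\}$ under the relation: $y \sim_x z$ if and only if there is $w > x$ with $w \leq y$ and $w \leq z$. The degree $\deg(x)$ of $x$ is the number (cardinality of the set) of components above $x$. A tree order is uniformly $\kappa$-branching if every point of it has degree $\kappa$. A tree order is rigid if its only order-automorphism (order-preserving bijection to itself with order-preserving inverse) is the identity. A continuous grading of a branchwise-real tree $X$ is a function $\ell \colon X \to \mathbb{R}$ such that $x < y$ implies $\ell(x) < \ell(y)$, and such that for all $x<y$ in $X$ the restriction of $\ell$ to $[x,y] = \{z \in X \mid x \leq z \leq y\}$ is an order-isomorphism onto the real interval $[\ell(x),\ell(y)]$. $X$ is continuously gradable if it admits a continuous grading. *)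

(* Defs.v *)
From HB Require Import structures.
From mathcomp Require Import all_boot all_order all_algebra.
From mathcomp Require Import all_classical all_reals.

Set Implicit Arguments.
Unset Strict Implicit.
Unset Printing Implicit Defensive.

Import Order.TTheory GRing.Theory Num.Theory.
Local Open Scope classical_set_scope.
Local Open Scope card_scope.
Local Open Scope order_scope.

(* A cardinal is represented by (the full set of) any type of that
   cardinality. *)
Definition card_lt (T U : Type) (A : set T) (B : set U) : Prop :=
  (A #<= B) /\ ~ (B #<= A).

Definition is_succ_card (T U : Type) (A : set T) (B : set U) : Prop :=
  card_lt A B /\
  forall (V : Type) (C : set V), card_lt A C -> B #<= C.

(* [f] is a total function, but only its values on [A] are relevant. *)
Definition order_iso_on (d d' : Order.disp_t)
    (T : porderType d) (U : porderType d')
    (A : set T) (B : set U) (f : T -> U) : Prop :=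
  set_bij A B f /\ {in A &, {mono f : x y / x <= y}}.

Section PartialOrders.
Context (d : Order.disp_t) (X : porderType d).

Definition is_chain (A : set X) : Prop :=
  total_on A (fun x y => x <= y).

Definition is_branch (B : set X) : Prop :=
  is_chain B /\ forall C : set X, is_chain C -> B `<=` C -> C = B.

Definition is_maximum (A : set X) (m : X) : Prop :=
  A m /\ forall z, A z -> z <= m.

Definition tree_order : Prop :=
  (forall x : X, is_chain [set y | y <= x]) /\
  exists r : X, forall x, r <= x.

Definition same_component (x y z : X) : Prop :=
  exists w : X, [/\ x < w, w <= y & w <= z].

Definition components_above (x : X) : set (set X) :=
  [set C | exists2 y : X, x < y &
           C = [set z | x < z /\ same_component x y z]].

Definition uniformly_branching (K : Type) : Prop :=
  forall x : X, components_above x #= [set: K].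

Definition order_automorphism (f : X -> X) : Prop :=
  exists g : X -> X,
    [/\ cancel f g, cancel g f,
        {homo f : x y / x <= y} & {homo g : x y / x <= y}].

Definition rigid : Prop :=
  forall f : X -> X, order_automorphism f -> f =1 id.

End PartialOrders.

Section BranchwiseReal.
Context (R : realType) (d : Order.disp_t) (X : porderType d).

Definition branchwise_real_tree : Prop :=
  [/\ tree_order X,
      forall B : set X, is_branch B ->
        exists (I : interval R) (f : X -> R), order_iso_on B [set` I] f
    & forall x y : X,
        exists m : X, is_maximum [set z | z <= x /\ z <= y] m].

Definition continuous_grading (l : X -> R) : Prop :=
  (forall x y : X, x < y -> l x < l y) /\
  (forall x y : X, x < y ->
     order_iso_on [set` `[x, y]] [set` `[l x, l y]] l).

Definition continuously_gradable : Prop :=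
  exists l : X -> R, continuous_grading l.

End BranchwiseReal.

Arguments tree_order {d} X.
Arguments uniformly_branching {d} X K.
Arguments rigid {d} X.
Arguments branchwise_real_tree R {d} X.
Arguments continuously_gradable R {d} X.

(* Main.v *)
Require Import Defs.
From HB Require Import structures.
From mathcomp Require Import all_boot all_order all_algebra.
From mathcomp Require Import all_classical all_reals.
From mathcomp Require Import ring lra zify.
From mathcomp Require Import num_normedtype normed_module.

(** The points of the tree are histories. A point at level [t >= 0] remembers a
label in [K * nat] for every level below [t], and it lies below another point
when its history is an initial segment of the other one. Labels are constant
on a short interval to the right of each level, so the component of [y] above
[x] is determined by the label [dir x y] that [y] takes at the level of [x],
and the level is a continuous grading. If the label [(k, n)] is in force just
before level [t], then the labels allowed at [t] are [(k, n)] itself and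
[(k', side k n t)] for the [k' <> k]. So there is one component for each
element of [K]. The number [n] is called the class of the component.

The asymmetry needed for rigidity comes from one restriction: a history may
change its label infinitely often below a level only if it eventually avoids
class 0 before that level. A component is called [tame] if it has a part [U]
that starts at its base, contains the start of all but countably many of the
components branching off close to any base point, and in which increasing
sequences are bounded. This is an order-theoretic property. Components of
positive class have it: let [U] avoid class 0, which [side] makes available at
countably many levels only ([tame_of_class_pos]). Components of class 0 do
not: class 0 is available at uncountably many levels, so inside any candidate
[U] one can enter class 0 again and again ([not_tame_of_class_zero]). Thus
automorphisms respect class 0. Close to the base of a component of class [n],
only classes at least [n - 1] branch off, and class [n - 1] does; so an
induction on [n] shows that automorphisms respect all classes
([class_automorphism]).

Let now [x] be a fixed point of an automorphism. On stems of class [n], the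
class [n + 2 + m] branches off only at the [m]-th rational level. Hence the
automorphism preserves the rational levels just above [x], and then all levels
just above [x]. At most other levels the class branching off is [n + 1] or
[n], according to a colouring [chi k] of the line; colourings of different
[k] differ on every interval, so no component above [x] is moved to another
one. Therefore the automorphism fixes an initial part of each component above
[x] ([automorphism_fixes_stem]), and a supremum argument along the points below
a given one shows that it fixes everything ([rigid_nodes]).

There are enough colourings because [K] injects into the power set of the
power set of [nat], and some map from the line to [set nat] is onto on every
interval, even after the removal of countably many points
([even_code_onto]). *)

Set Implicit Arguments.
Unset Strict Implicit.
Unset Printing Implicit Defensive.

Import Order.TTheory GRing.Theory Num.Theory.
Local Open Scope classical_set_scope.
Local Open Scope card_scope.

(** * A map from the line onto the subsets of nat on every interval *)

Section Digits.
Context (R : realType).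
Local Open Scope ring_scope.

Definition odd_digit (t : R) (j : nat) : Prop :=
  exists z : int, Num.floor (4 ^+ j * t) = z * 2 + 1.

Lemma nested_sup (y z : nat -> R) :
  (forall m, y m <= y m.+1) -> (forall m, z m.+1 <= z m) ->
  (forall m, y m <= z m) ->
  exists t, forall m, y m <= t <= z m.
Proof.
move=> ymono zmono yz.
have ylt m n : (m <= n)%N -> y m <= y n.
  by move=> /subnK <-; elim: (n - m)%N => // p IH; exact: le_trans IH (ymono _).
have zlt m n : (m <= n)%N -> z n <= z m.
  by move=> /subnK <-; elim: (n - m)%N => // p IH; exact: le_trans (zmono _) IH.
have yzmn m n : y m <= z n.
  apply: le_trans (ylt _ _ (leq_maxl m n)) _.
  exact: le_trans (yz _) (zlt _ _ (leq_maxr m n)).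
exists (sup (range y)) => m; apply/andP; split.
  apply: ub_le_sup; last by exists m.
  by exists (z m) => _ [n _ <-].
by apply: ge_sup; [exists (y 0%N), 0%N | move=> _ [n _ <-]].
Qed.

(** Base 4 leaves room: a number all of whose late digits are 0 or 1 stays away
from the next multiple of a power of 1/4, so its integer parts can be read off
exactly. *)
Lemma prescribed_digits (a b : R) (d : nat -> bool) : a < b ->
  exists t N, a < t < b /\
    forall j, (N < j)%N -> odd_digit t j <-> d j.
Proof.
move=> ab.
have [N hN] : exists N : nat, 2 < (b - a) * 4 ^+ N.
  pose N := Num.Def.archi_bound (2 / (b - a)).
  exists N.
  have ba0 : 0 < b - a by lra.
  have h : 2 / (b - a) < N%:R by apply: archi_boundP; rewrite divr_ge0 // ltW.
  have h4 : N%:R < (4 ^+ N : R) by rewrite -natrX ltr_nat ltn_expl.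
  by rewrite mulrC -ltr_pdivrMr //; exact: lt_trans h h4.
pose p : int := Num.floor (4 ^+ N * a) + 1.
pose Q := fix Q (m : nat) : int :=
  if m is m'.+1 then Q m' * 4 + (d (N + m)%N)%:Z else p.
have QS m : Q m.+1 = Q m * 4 + (d (N + m.+1)%N)%:Z by [].
pose e m : R := (4 ^+ (N + m))^-1.
have e_gt0 m : 0 < e m by rewrite invr_gt0 exprn_gt0.
have eS m : e m = 4 * e m.+1.
  by rewrite /e addnS exprS invfM mulrA divff ?mul1r // pnatr_eq0.
pose y m : R := (Q m)%:~R * e m.
(* With digits at most 1, the tail after position [N + m] is at most [e m / 3]. *)
pose z m : R := ((Q m)%:~R + 1 / 3) * e m.
have yS m : y m.+1 = y m + (d (N + m.+1)%N)%:R * e m.+1.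
  by rewrite /y QS (eS m) intrD intrM rmorph_nat -pmulrn; ring.
have zS m : z m.+1 = z m - (1 - (d (N + m.+1)%N)%:R) * e m.+1.
  by rewrite /z QS (eS m) intrD intrM rmorph_nat -pmulrn; field.
have [t ht] : exists t, forall m, y m <= t <= z m.
  apply: nested_sup => m.
  - by rewrite yS lerDl mulr_ge0 // ltW.
  - rewrite zS gerBl mulr_ge0 ?(ltW (e_gt0 _)) //.
    by case: (d _); rewrite ?subrr ?subr0.
  - by rewrite /y /z ler_pM2r //; lra.
exists t, N; split.
  have /andP[h1 h2] := ht 0%N; move: h1 h2; rewrite /y /z /e addn0 /=.
  set E := 4 ^+ N in hN *; have E0 : 0 < E by rewrite exprn_gt0.
  rewrite ler_pdivrMr // ler_pdivlMr //.
  have /andP[f1 f2] := floor_itv (E * a).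
  move: f1 f2; rewrite /p -/E !rmorphD /=; set F := (Num.floor _)%:~R => f1 f2 g1 g2.
  by rewrite -(ltr_pM2r E0) -[t < b](ltr_pM2r E0); lra.
move=> j Nj; have [m ->] : exists m, j = (N + m.+1)%N.
  by exists (j - N.+1)%N; rewrite addnS -addSn subnKC.
have fl : Num.floor (4 ^+ (N + m.+1) * t) = Q m.+1.
  apply: floor_def; have /andP[] := ht m.+1; rewrite /y /z /e.
  have E0 : 0 < 4 ^+ (N + m.+1) :> R by rewrite exprn_gt0.
  rewrite ler_pdivrMr // ler_pdivlMr // rmorphD /=.
  by move: (4 ^+ (N + m.+1)) => E; lra.
rewrite /odd_digit fl QS; case: (d _) => /=; split=> //.
- by move=> _; exists (Q m * 2); rewrite -mulrA.
- by case=> w /= h; exfalso; lia.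
Qed.

(** The number [n] is encoded in the digits at the positions [2 ^ n * odd].
Asking for arbitrarily late odd digits makes the code depend on the tail of
the expansion only, hence onto on every interval. *)
Definition code (t : R) : set nat :=
  [set n | forall N, exists j, [/\ (N < j)%N, logn 2 j = n & odd_digit t j]].

Lemma code_onto (a b : R) (S : set nat) : a < b ->
  exists2 t, a < t < b & code t = S.
Proof.
move=> ab; pose d j := `[< S (logn 2 j) >].
have [t [N [tab ht]]] := prescribed_digits d ab.
exists t => //; apply/seteqP; split=> n.
  by move=> /(_ N)[j [Nj <- /ht-/(_ Nj)/asboolP]].
move=> Sn M; pose j := (2 ^ n * (maxn M N).*2.+1)%N.
have jn : logn 2 j = n.
  rewrite /j lognM ?expn_gt0 // pfactorK // lognE /= dvdn2 /= odd_double /=.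
  by rewrite addn0.
have jlt : (maxn M N < j)%N.
  rewrite /j; apply: (@leq_trans (maxn M N).*2.+1); first by lia.
  by rewrite leq_pmull ?expn_gt0.
have [Mj Nj] : (M < j)%N /\ (N < j)%N by lia.
by exists j; split => //; apply/ht => //; apply/asboolP; rewrite jn.
Qed.

(** Reading the even numbers only leaves the odd ones free to diagonalise
against a sequence of forbidden points. *)
Definition even_code (t : R) : set nat := [set n | code t n.*2].

Lemma even_code_onto (a b : R) (S : set nat) (e : nat -> R) : a < b ->
  exists t, [/\ a < t < b, even_code t = S & forall n, t <> e n].
Proof.
move=> ab.
pose S' := [set m | if odd m then ~ code (e m./2) m else S m./2].
have [t tab ct] := code_onto S' ab.
exists t; split=> //.
  by apply/seteqP; split=> n; rewrite /even_code ct /S' /= odd_double doubleK.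
move=> n te; have : code t n.*2.+1 <-> ~ code (e n) n.*2.+1.
  by rewrite ct /S' /= odd_double /= uphalf_double.
by rewrite te; tauto.
Qed.

End Digits.

Section Colours.
Context (R : realType) (K : Type).
Local Open Scope ring_scope.

(** Leaving out an arbitrary sequence of points lets the colouring be overruled
at countably many levels later on. *)
Definition separating (chi : K -> R -> Prop) : Prop :=
  forall k k', k <> k' -> forall (e : nat -> R) a b, a < b ->
  exists t, [/\ a < t < b, forall n, t <> e n, chi k t & ~ chi k' t].

Lemma ex_separating (phi : K -> set (set nat)) : injective phi ->
  exists chi : K -> R -> Prop, separating chi.
Proof.
move=> phi_inj.
pose low (t : R) : set nat := [set n | even_code t n.+1].
(* The bit at 0 reverses the colour, so that both orders of the two different
   values occur on every interval. *)
exists (fun k t => even_code t 0%N <-> phi k (low t)) => k k' kk' e a b ab.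
have [S hS] : exists S, ~ (phi k S <-> phi k' S).
  apply: contrapT => h; apply/kk'/phi_inj/seteqP.
  by split=> S; have := contrapT (fun h' => h (ex_intro _ S h')); tauto.
pose S' : set nat := [set n | if n is n'.+1 then S n' else phi k S].
have [t [tab ct te]] := even_code_onto S' e ab.
have lt : low t = S by rewrite /low ct.
by exists t; split; rewrite // lt ct /S' /=; tauto.
Qed.

End Colours.

Lemma inj_of_card_le (T U : Type) : [set: T] #<= [set: U] ->
  exists f : T -> U, injective f.
Proof.
move/card_leP => [f].
exists (fun x => val (f (to_setT x))) => x y /val_inj/(@inj _ _ _ f).
by move=> /(_ (in_setT _) (in_setT _)) [].
Qed.

Lemma succ_card_le_powerset (T U : Type) :
  is_succ_card [set: T] [set: U] -> [set: U] #<= [set: set T].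
Proof.
case=> _; apply; split.
  have i : injective (fun x : T => [set x]).
    by move=> x y /seteqP[h _]; apply: h.
  have := inj_card_eq (in2W i : {in setT &, injective _}).
  rewrite card_eq_le => /andP[_ /card_le_trans]; apply.
  exact: subset_card_le.
move=> /inj_of_card_le [f fi].
(* Cantor's diagonal set for an injection [f] of [set T] into [T]. *)
pose D : set T := [set x | exists2 A : set T, x = f A & ~ A x].
have nD : ~ D (f D) by move=> DfD; have [A /fi <-] := DfD.
by apply: (nD); exists D.
Qed.

(** * Histories *)

Section Histories.
Local Open Scope ring_scope.
Context (R : realType) (K : Type) (k0 : K) (side : K -> nat -> R -> nat).
Implicit Types (f g : R -> K * nat) (i j : K * nat) (s t u : R).

(** The label at all levels outside the domain of a history. It serves at
negative levels as a stem leading to the root, so that the root branches by the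
same rule as the other points. *)
Definition base : K * nat := (k0, 0%N).

Definition before f s i : Prop :=
  exists2 e, e < s & forall u, e < u < s -> f u = i.

Definition allowed f s j : Prop :=
  (forall i, before f s i ->
     j = i \/ j.1 <> i.1 /\ j.2 = side i.1 i.2 s) /\
  (~ (exists i, before f s i) -> j.2 = 0%N).

(** The condition [history_left] is what destroys homogeneity: label changes may
accumulate from the left at a level only if class 0 does not occur just before
it. *)
Record history t f : Prop := History {
  history_ge0 : 0 <= t;
  history_out : forall u, u < 0 \/ t <= u -> f u = base;
  history_allowed : forall u, u < t -> allowed f u (f u);
  history_right : forall u, u < t ->
    exists2 e, u < e & forall v, u <= v < e -> v < t -> f v = f u;
  history_left : forall u, u <= t ->
    (exists i, before f u i) \/
    exists2 e, e < u & forall v, e < v < u -> (f v).2 <> 0%N }.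

Definition agree f g t : Prop := forall u, u < t -> f u = g u.

Lemma agree_le f g s t : s <= t -> agree f g t -> agree f g s.
Proof. by move=> st h u us; apply: h; exact: lt_le_trans us st. Qed.

Lemma agree_sym f g t : agree f g t -> agree g f t.
Proof. by move=> h u /h. Qed.

Lemma before_agree f g s i : agree f g s -> before f s i -> before g s i.
Proof.
move=> fg [e es h]; exists e => // u /andP[eu us].
by rewrite -fg // h // eu us.
Qed.

Lemma allowed_agree f g s j : agree f g s -> allowed f s j -> allowed g s j.
Proof.
move=> fg [h1 h2]; split=> [i /(before_agree (agree_sym fg))/h1 //|nb].
by apply: h2 => -[i /(before_agree fg)] b; apply: nb; exists i.
Qed.

Lemma before_inj f s i j : before f s i -> before f s j -> i = j.
Proof.
move=> [e es he] [e' es' he'].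
have m : Num.max e e' < s by rewrite gt_max es.
pose u := (Num.max e e' + s) / 2.
have [h1 h2] : Num.max e e' < u /\ u < s by rewrite /u; split; lra.
move: h1; rewrite gt_max => /andP[eu e'u].
by rewrite -(he u) ?eu // -(he' u) ?e'u.
Qed.

(** This makes the degree equal to the cardinality of [K] at each point. *)
Lemma allowed_unique f s k :
  exists n, forall j, j.1 = k -> allowed f s j <-> j.2 = n.
Proof.
have [[[k1 n1] b]|nb] := pselect (exists i, before f s i); last first.
  exists 0%N => j _; split=> [[_]|j0]; first exact.
  by split=> // i b; case: nb; exists i.
have [->|kk1] := pselect (k = k1).
  exists n1 => -[k' n'] /= ->; split.
    by move=> [/(_ _ b)[[->]|[/=]] //].
  move=> ->; split=> [i /(before_inj b) <-|[]]; [by left|by exists (k1, n1)].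
exists (side k1 n1 s) => -[k' n'] /= ->; split.
  by move=> [/(_ _ b)[[]|[]] //].
by move=> ->; split=> [i /(before_inj b) <-|[]]; [by right|by exists (k1, n1)].
Qed.

Lemma history_local t f g s :
  0 <= s <= t -> history t f -> agree f g s ->
  (forall u, s <= u -> g u = base) -> history s g.
Proof.
move=> /andP[s0 st] hf fg gout; have gf := agree_sym fg.
split=> // u.
- case=> [u0|/gout //]; rewrite -fg; last exact: lt_le_trans s0.
  by apply: (history_out hf); left.
- move=> us; rewrite -fg //.
  apply: (allowed_agree (agree_le (ltW us) fg)).
  by apply: (history_allowed hf); exact: lt_le_trans st.
- move=> us; have [e ue he] := history_right hf (lt_le_trans us st).
  by exists e => // v uve vs; rewrite -!fg // he // (lt_le_trans vs).
- move=> us; have [[i b]|[e eu he]] := history_left hf (le_trans us st).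
    by left; exists i; exact: before_agree (agree_le us fg) b.
  right; exists e => // v /andP[ev vu].
  rewrite -fg; first by apply: he; rewrite ev.
  exact: lt_le_trans vu us.
Qed.

Definition cut f t u := if u < t then f u else base.

Lemma history_cut t f s : 0 <= s <= t -> history t f -> history s (cut f s).
Proof.
move=> st hf; apply: (history_local st hf) => u; rewrite /cut; first by move->.
by rewrite ltNge => ->.
Qed.

Definition prolong f t j s u := if u < t then f u else if u < s then j else base.

(** An allowed label can be kept forever, since it remains allowed as long as it
is in force. *)
Lemma history_prolong t f j s : history t f -> allowed f t j -> t < s ->
  history s (prolong f t j s).
Proof.
move=> hf aj ts; set g := prolong _ _ _ _.
have fg : agree f g t by move=> u; rewrite /g /prolong => ->.
have gf := agree_sym fg.
have gj u : t <= u < s -> g u = j.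
  by rewrite /g /prolong leNgt => /andP[/negbTE -> ->].
have t0 := history_ge0 hf.
have bj u : t < u <= s -> before g u j.
  move=> /andP[tu us]; exists t => // v /andP[tv vu]; apply: gj.
  by rewrite ltW //= (lt_le_trans vu).
split=> [|u|u us|u us|u us].
- by lra.
- case=> [u0|su].
    by rewrite -fg ?(history_out hf) //; [left | lra].
  by rewrite /g /prolong !ltNge su (le_trans (ltW ts) su).
- have [ut|tu] := ltP u t.
    rewrite -fg //; apply: (allowed_agree (agree_le (ltW ut) fg)).
    exact: (history_allowed hf).
  rewrite gj ?tu //.
  have [<-|ut] := eqVneq t u; first exact: allowed_agree fg aj.
  have b : before g u j by apply: bj; rewrite lt_neqAle ut tu ltW.
  by split=> [i /(before_inj b) <-|[]]; [left | exists j].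
- have [ut|tu] := ltP u t.
    have [e ue he] := history_right hf ut.
    exists (Num.min e t); rewrite ?lt_min ?ue //.
    move=> v /andP[uv]; rewrite lt_min => /andP[ve vt] _.
    by rewrite -!fg // he ?uv.
  by exists s => // v /andP[uv vs] _; rewrite !gj ?tu ?(le_trans tu uv).
- have [ut|tu] := leP u t; last by left; exists j; apply: bj; rewrite tu.
  have [[i b]|[e eu he]] := history_left hf ut.
    by left; exists i; exact: before_agree (agree_le ut fg) b.
  right; exists e => // v /andP[ev vu].
  rewrite -fg; first by apply: he; rewrite ev.
  exact: lt_le_trans vu ut.
Qed.

Record node := Node { lev : R; typ : R -> K * nat; nodeP : history lev typ }.
Implicit Types x y z v w : node.

Lemma node_inj x y : lev x = lev y -> agree (typ x) (typ y) (lev x) -> x = y.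
Proof.
case: x y => [t f hf] [t' g hg] /= e; case: t' / e hg => hg fg.
have e : f = g.
  apply/funext => u; have [/fg //|tu] := ltP u t.
  by rewrite (history_out hf) ?(history_out hg) //; right.
by case: g / e hg fg => hg _; rewrite (Prop_irrelevance hf hg).
Qed.

Definition node_le x y : bool :=
  `[< lev x <= lev y /\ agree (typ x) (typ y) (lev x) >].

Lemma node_le_refl : reflexive node_le.
Proof. by move=> x; apply/asboolP; split. Qed.

Lemma node_le_anti : antisymmetric node_le.
Proof.
move=> x y /andP[/asboolP[xy h] /asboolP[yx _]].
by apply: node_inj => //; apply/eqP; rewrite eq_le xy.
Qed.

Lemma node_le_trans : transitive node_le.
Proof.
move=> y x z /asboolP[xy h] /asboolP[yz h']; apply/asboolP.
split=> [|u ux]; first exact: le_trans yz.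
by rewrite h // h' // (lt_le_trans ux).
Qed.

End Histories.

(** * The order on histories *)

HB.instance Definition _ R K k0 side :=
  gen_eqMixin (@node R K k0 side).
HB.instance Definition _ R K k0 side :=
  gen_choiceMixin (@node R K k0 side).
HB.instance Definition _ R K k0 side :=
  Order.Le_isPOrder.Build ring_display (@node R K k0 side)
    (@node_le_refl R K k0 side) (@node_le_anti R K k0 side)
    (@node_le_trans R K k0 side).

Section Nodes.
Local Open Scope ring_scope.
Context (R : realType) (K : Type) (k0 : K) (side : K -> nat -> R -> nat).
Local Notation node := (node k0 side).
Implicit Types (x y z v w : node) (s t u : R) (i j : K * nat).

Lemma le_nodeP x y :
  reflect (lev x <= lev y /\ agree (typ x) (typ y) (lev x)) (x <= y).
Proof. exact: asboolP. Qed.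

Lemma lev_le x y : x <= y -> lev x <= lev y.
Proof. by case/le_nodeP. Qed.

Lemma typ_le x y u : x <= y -> u < lev x -> typ x u = typ y u.
Proof. by case/le_nodeP => _; apply. Qed.

Lemma lev_lt x y : x < y -> lev x < lev y.
Proof.
rewrite lt_neqAle => /andP[/eqP xy le]; rewrite lt_neqAle lev_le // andbT.
by apply/eqP => e; apply/xy/node_inj => //; case/le_nodeP: le.
Qed.

Lemma lt_lev x y : x <= y -> lev x < lev y -> x < y.
Proof.
rewrite [x < y]lt_neqAle => -> h; rewrite andbT.
by apply: contraTneq h => ->; rewrite ltxx.
Qed.

Lemma le_below x y z : x <= z -> y <= z -> lev x <= lev y -> x <= y.
Proof.
move=> xz yz xy; apply/le_nodeP; split=> // u ux.
by rewrite (typ_le xz ux) (typ_le yz) // (lt_le_trans ux).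
Qed.

Lemma lt_below x y z : x <= z -> y <= z -> lev x < lev y -> x < y.
Proof. by move=> xz yz xy; apply: lt_lev => //; exact: le_below xz yz (ltW xy). Qed.

Lemma clamp_itv y s : 0 <= Num.max 0 (Num.min s (lev y)) <= lev y.
Proof. by rewrite le_max lexx ge_max (history_ge0 (nodeP y)) ge_min lexx orbT. Qed.

Definition restr y s : node := Node (history_cut (clamp_itv y s) (nodeP y)).

Lemma lev_restr y s : 0 <= s <= lev y -> lev (restr y s) = s.
Proof. by move=> /andP[s0 sy] /=; rewrite min_l // max_r. Qed.

Lemma restr_le y s : restr y s <= y.
Proof.
apply/le_nodeP; split; first by case/andP: (clamp_itv y s).
by move=> u /=; rewrite /cut => ->.
Qed.

Lemma restr_lev x y : x <= y -> restr y (lev x) = x.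
Proof.
move=> xy; have e : lev (restr y (lev x)) = lev x.
  by rewrite lev_restr // (history_ge0 (nodeP x)) lev_le.
apply: node_inj => // u; rewrite e => ux.
by rewrite (typ_le (restr_le _ _)) ?e // (typ_le xy).
Qed.

Lemma lev_ge0 x : 0 <= lev x. Proof. exact: history_ge0 (nodeP x). Qed.

Lemma restr_between x y s : x <= y -> lev x < s <= lev y ->
  [/\ x < restr y s, restr y s <= y & lev (restr y s) = s].
Proof.
move=> xy /andP[xs sy]; have e : lev (restr y s) = s.
  by rewrite lev_restr // sy (le_trans (lev_ge0 x)) // ltW.
by split=> //; [apply: (lt_below xy) => //|]; rewrite ?e //; exact: restr_le.
Qed.

(** For [x < y], this label identifies the component of [y] above [x]. *)
Definition dir x y := typ y (lev x).

Lemma dir_le x w y : x < w -> w <= y -> dir x w = dir x y.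
Proof. by move=> xw wy; rewrite /dir (typ_le wy) // lev_lt. Qed.

Lemma dir_allowed x y : x < y -> allowed side (typ x) (lev x) (dir x y).
Proof.
move=> xy; have := history_allowed (nodeP y) (lev_lt xy).
by apply: allowed_agree => u ux; rewrite (typ_le (ltW xy)).
Qed.

(** No label change happens between [x] and [y]; a component above [x] begins
with such a segment, and what branches off from it is governed by [side]. *)
Definition stem x y := forall u, lev x <= u < lev y -> typ y u = dir x y.

Lemma stem_ex x y : x < y -> exists y', [/\ x < y', y' <= y & stem x y'].
Proof.
move=> xy; have xy' := lev_lt xy.
have [e xe he] := history_right (nodeP y) (lev_lt xy).
pose s := Num.min e (lev y).
have [||h1 h2 h3] := @restr_between x y s; first exact: ltW.
  by rewrite lt_min xe xy' ge_min lexx orbT.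
exists (restr y s); split=> // u /andP[xu]; rewrite h3 => us.
rewrite (dir_le h1 h2) (typ_le h2) ?h3 //; move: us; rewrite lt_min => /andP[ue uy].
by rewrite he ?xu.
Qed.

Lemma stem_before x w y : stem x y -> x < w -> w <= y ->
  before (typ w) (lev w) (dir x y).
Proof.
move=> st xw wy; exists (lev x); first exact: lev_lt.
move=> u /andP[xu uw]; rewrite (typ_le wy) // st // ltW //=.
by rewrite (lt_le_trans uw) // lev_le.
Qed.

Lemma dir_options w v i : before (typ w) (lev w) i -> w < v ->
  dir w v = i \/ (dir w v).1 <> i.1 /\ (dir w v).2 = side i.1 i.2 (lev w).
Proof. by move=> b /dir_allowed[+ _]; apply. Qed.

Lemma prolong_ex x j s : allowed side (typ x) (lev x) j -> lev x < s ->
  exists y, [/\ x < y, lev y = s & forall u, lev x <= u < s -> typ y u = j].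
Proof.
move=> aj xs; have hy := history_prolong (nodeP x) aj xs.
exists (Node hy); split=> //.
- apply: lt_lev => //; apply/le_nodeP; split; first exact: ltW.
  by move=> u /=; rewrite /prolong => ->.
- by move=> u /andP[]; rewrite /= /prolong leNgt => /negbTE -> ->.
Qed.

Lemma dir_ex x j : allowed side (typ x) (lev x) j ->
  exists2 y, x < y & dir x y = j.
Proof.
move=> aj; have xx : lev x < lev x + 1 by lra.
have [y [xy ly hy]] := prolong_ex aj xx.
by exists y => //; apply: hy; rewrite lexx.
Qed.

Lemma side_ex w i k : before (typ w) (lev w) i -> k <> i.1 ->
  exists2 v, w < v & dir w v = (k, side i.1 i.2 (lev w)).
Proof.
move=> b ki; apply: dir_ex; split=> [j /(before_inj b) <-|[]]; first by right.
by exists i.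
Qed.

(** Right-continuity of labels: two histories that agree up to and including
level [lev x] agree a little longer. *)
Lemma dir_fork x y z : x < y -> x < z -> dir x y = dir x z ->
  exists w, [/\ x < w, w <= y & w <= z].
Proof.
move=> xy xz d; have [y1 [xy1 y1y sy]] := stem_ex xy.
have [z1 [xz1 z1z sz]] := stem_ex xz.
have [h1 h2] := (lev_lt xy1, lev_lt xz1).
pose s := Num.min (lev y1) (lev z1).
have [||xw wy1 e] := @restr_between x y1 s; first exact: ltW.
  by rewrite lt_min h1 h2 ge_min lexx.
exists (restr y1 s); split=> //; first exact: le_trans y1y.
apply: (le_trans _ z1z); apply/le_nodeP; split; first by rewrite e ge_min lexx orbT.
rewrite e => u; rewrite lt_min => /andP[uy uz].
rewrite (typ_le wy1) ?e ?lt_min ?uy //.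
have [ux|xu] := ltP u (lev x).
  by rewrite -(typ_le (ltW xy1)) // -(typ_le (ltW xz1)).
by rewrite sy ?xu // sz ?xu // (dir_le xy1 y1y) (dir_le xz1 z1z).
Qed.

Lemma same_componentP x y z : x < y -> x < z ->
  same_component x y z <-> dir x y = dir x z.
Proof.
move=> xy xz; split=> [[w [xw wy wz]]|]; last exact: dir_fork.
by rewrite -(dir_le xw wy) (dir_le xw wz).
Qed.

Lemma uniformly_branching_nodes : uniformly_branching node K.
Proof.
move=> x.
have [n hn] := choice (allowed_unique side (typ x) (lev x)).
pose C k := [set z | x < z /\ (dir x z).1 = k].
have CE y : x < y -> C (dir x y).1 = [set z | x < z /\ same_component x y z].
  move=> xy; apply/seteqP; split=> z [xz h]; split=> //.
    apply/same_componentP => //.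
    have /(hn _ _ erefl) := dir_allowed xy; have /(hn _ _ h) := dir_allowed xz.
    by rewrite [dir x y]surjective_pairing [dir x z]surjective_pairing h /= => -> ->.
  by have /same_componentP <- := h.
have Cne k : exists2 y, x < y & (dir x y).1 = k.
  have [|y xy d] := @dir_ex x (k, n k); first by apply/(hn k).
  by exists y; rewrite ?d.
have -> : components_above x = C @` setT.
  apply/seteqP; split=> [_ [y xy ->]|_ [k _ <-]].
    by exists (dir x y).1 => //; exact: CE.
  by have [y xy <-] := Cne k; exists y => //; rewrite CE.
apply: inj_card_eq => k k' _ _ e; have [y xy d] := Cne k.
have : C k y by [].
by rewrite e => -[_]; rewrite d.
Qed.

End Nodes.

(** * Branches, meets and the grading *)

Section Tree.
Local Open Scope ring_scope.
Context (R : realType) (K : Type) (k0 : K) (side : K -> nat -> R -> nat).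
Local Notation node := (node k0 side).
Implicit Types (x y z v w : node) (s t u : R) (i j : K * nat).

Lemma lev_eq x y : x <= y -> lev x = lev y -> x = y.
Proof. by move=> h e; rewrite -(restr_lev h) e restr_lev. Qed.

Lemma history_root : history k0 side 0 (fun=> base k0).
Proof.
have b u : before (fun=> base k0) u (base k0).
  by exists (u - 1) => //; lra.
split=> // u _.
- by split=> [i /(before_inj (b u)) <-|[]]; [left | exists (base k0)].
- by exists (u + 1) => //; lra.
- by left; exists (base k0).
Qed.

Lemma ex_root : exists r : node, forall x, r <= x.
Proof.
exists (Node history_root) => x; apply/le_nodeP; split=> [|u u0]; first exact: lev_ge0.
by rewrite (history_out (nodeP x)) //; left.
Qed.

Lemma tree_order_nodes : tree_order node.
Proof.
split; last exact: ex_root.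
move=> z x y xz yz; have [xy|/ltW yx] := leP (lev x) (lev y).
  by left; exact: le_below xz yz xy.
by right; exact: le_below yz xz yx.
Qed.

(** The meet sits at the supremum of the levels up to which [x] and [y] agree. *)
Lemma ex_meet x y : exists m, is_maximum [set z | z <= x /\ z <= y] m.
Proof.
pose S := [set s | [/\ 0 <= s, s <= lev x, s <= lev y & agree (typ x) (typ y) s]].
have S0 : S 0.
  split; rewrite ?lev_ge0 // => u u0.
  by rewrite !(history_out (nodeP _)) //; left.
have Sx : ubound S (lev x) by move=> s [].
have Sy : ubound S (lev y) by move=> s [].
have bS : has_ubound S by exists (lev x).
have nS : S !=set0 by exists 0.
have lx : lev (restr x (sup S)) = sup S.
  by rewrite lev_restr // (ub_le_sup bS S0) (ge_sup nS Sx).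
exists (restr x (sup S)); split=> [|z [zx zy]].
  split; first exact: restr_le.
  apply/le_nodeP; rewrite lx; split; first exact: ge_sup.
  move=> u uS; rewrite (typ_le (restr_le _ _)) ?lx //.
  have [|s [_ _ _ h] us] := @sup_adherent _ S (sup S - u) _ (conj nS bS); first lra.
  by apply: h; lra.
apply: (le_below zx (restr_le _ _)); rewrite lx; apply: ub_le_sup => //.
split; rewrite ?lev_ge0 ?lev_le // => u uz.
by rewrite -(typ_le zx) // -(typ_le zy).
Qed.

Lemma branch_down (B : set node) x z : is_branch B -> B x -> z <= x -> B z.
Proof.
move=> [cB mB] Bx zx.
rewrite -(mB (B `|` [set z])); [by right| |by left].
have cz b : B b -> z <= b \/ b <= z.
  move=> Bb; have [xb|bx] := cB _ _ Bx Bb; first by left; exact: le_trans xb.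
  by have [c _] := tree_order_nodes; apply: (c x).
move=> a b [Ba|->] [Bb|->].
- exact: cB.
- by have [] := cz _ Ba; [right | left].
- exact: cz.
- by left.
Qed.

Lemma branch_interval (B : set node) : is_branch B ->
  exists (I : interval R) (f : node -> R), order_iso_on B [set` I] f.
Proof.
move=> bB; have [cB _] := bB.
have iB : is_interval (@lev R K k0 side @` B).
  move=> _ _ [x Bx <-] [y By <-] t /andP[xt ty].
  have e : lev (restr y t) = t by rewrite lev_restr // (le_trans (lev_ge0 x) xt).
  by exists (restr y t) => //; exact: branch_down bB By (restr_le _ _).
exists (Rhull (@lev R K k0 side @` B)), (@lev R K k0 side); split.
  rewrite RhullK ?inE //; split.
  - by move=> x Bx; exists x.
  - move=> x y; rewrite !inE => Bx By e.
    by have [h|h] := cB _ _ Bx By; [exact: lev_eq | symmetry; exact: lev_eq].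
  - by move=> _ [x Bx <-]; exists x.
move=> x y; rewrite !inE => Bx By; apply/idP/idP => [h|]; last exact: lev_le.
have [//|yx] := cB _ _ Bx By.
by apply: (le_below _ yx).
Qed.

Lemma branchwise_real_nodes : branchwise_real_tree R node.
Proof.
split; [exact: tree_order_nodes | exact: branch_interval | exact: ex_meet].
Qed.

Lemma continuously_gradable_nodes : continuously_gradable R node.
Proof.
exists (@lev R K k0 side); split=> x y xy; first exact: lev_lt.
split; last first.
  move=> a b; rewrite !inE /= !in_itv /= => /andP[xa ay] /andP[xb by_].
  by apply/idP/idP; [exact: le_below ay by_ | exact: lev_le].
split.
- by move=> z /=; rewrite !in_itv /= => /andP[xz zy]; rewrite !lev_le.
- move=> a b; rewrite !inE /= !in_itv /= => /andP[xa ay] /andP[xb by_] e.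
  by rewrite -(restr_lev ay) e restr_lev.
- move=> s /=; rewrite in_itv /= => /andP[xs sy].
  have e : lev (restr y s) = s by rewrite lev_restr // sy (le_trans (lev_ge0 x)).
  exists (restr y s) => //; rewrite /= in_itv /= restr_le andbT.
  by apply: (le_below (ltW xy) (restr_le _ _)); rewrite e.
Qed.
End Tree.

(** * Tame components *)

Section Automorphisms.
Context (d : Order.disp_t) (X : porderType d).
Local Open Scope order_scope.
Implicit Types (x y z v w : X) (f g : X -> X) (U : set X).

Definition inverse_automorphisms f g : Prop :=
  [/\ cancel f g, cancel g f,
      {homo f : x y / x <= y} & {homo g : x y / x <= y}].

Lemma inverse_automorphisms_sym f g :
  inverse_automorphisms f g -> inverse_automorphisms g f.
Proof. by case. Qed.

Lemma automorphism_le f g : inverse_automorphisms f g ->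
  {mono f : x y / x <= y}.
Proof.
by case=> fg _ hf hg x y; apply/idP/idP => [/hg|/hf //]; rewrite !fg.
Qed.

Lemma automorphism_lt f g : inverse_automorphisms f g ->
  {mono f : x y / x < y}.
Proof.
move=> a x y; rewrite !lt_neqAle (automorphism_le a).
by case: a => /can_eq ->.
Qed.

Definition misses U w : Prop :=
  exists2 v, w < v & forall w', w < w' <= v -> ~ U w'.

(** Only order-theoretic notions occur here, so automorphisms preserve tameness.
The exceptional points are collected on short segments (there would be too many
of them in all of [U]), and their countability is expressed by an enumeration
[e], which is easy to transport. *)
Definition tame_witness x y U : Prop :=
  [/\ exists2 y', x < y' <= y & U y',
      forall w v, x < w -> w <= v -> U v -> U w,
      forall z v, x <= z -> z < v -> U v ->
        exists2 v', z < v' <= v & exists e : nat -> X,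
          forall w, z < w < v' -> misses U w -> exists n, w = e n
    & forall u : nat -> X, (forall n, U (u n)) -> (forall n, u n < u n.+1) ->
        exists b, forall n, u n <= b].

Definition tame x y : Prop := exists U, tame_witness x y U.

Lemma tame_automorphism f g x y : inverse_automorphisms f g ->
  tame x y -> tame (f x) (f y).
Proof.
move=> a [U [[y' /andP[xy' y'y] Uy'] down most bound]].
have [le lt] := (automorphism_le a, automorphism_lt a).
have [fg gf _ _] := a.
exists (U \o g); split=> [|w v|z v|u Uu ui] /=.
- by exists (f y'); rewrite ?fg //; rewrite lt xy' le.
- by rewrite -(gf w) -(gf v) lt le !fg; exact: down.
- rewrite -(gf z) -(gf v) le lt !fg => xz zv Uv.
  have [v' /andP[zv' v'v] [e he]] := most _ _ xz zv Uv.
  exists (f v'); rewrite ?lt ?le ?zv' //; exists (f \o e) => w.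
  rewrite -(gf w) !lt => zwv' [v1]; rewrite -(gf v1) lt => wv1 h.
  have [|n ->] := he _ zwv'; last by exists n.
  exists (g v1) => // w' ww'v1 Uw'.
  by apply: (h (f w')); rewrite /= ?fg // lt le.
- have [||b hb] := bound (g \o u); first exact: Uu.
    by move=> n; rewrite -lt /= !gf.
  by exists (f b) => n; rewrite -(gf (u n)) le; exact: hb.
Qed.

End Automorphisms.

(** * Automorphisms respect classes *)

Section Rigidity.
Local Open Scope ring_scope.
Context (R : realType) (K : Type).

(** What rigidity needs from [side]. The first three conditions concern class 0
and bound the drop of classes; together with [law_pred] they let automorphisms
respect classes. [law_mark] makes a dense set of levels recognisable on all
stems of one class, and [law_separate] tells stems with different [k] apart. *)
Record branching_law (side : K -> nat -> R -> nat) : Prop := BranchingLaw {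
  law_ge : forall k n t, (n.-1 <= side k n t)%N;
  law_zero_rare : forall k n, n <> 0%N -> exists e : nat -> R,
    forall t, side k n t = 0%N -> exists m, t = e m;
  law_zero_often : forall k a b (e : nat -> R), a < b ->
    exists t, [/\ a < t < b, forall m, t <> e m & side k 0%N t = 0%N];
  law_pred : forall k n a b, a < b ->
    exists2 t, a < t < b & side k n t = n.-1;
  law_mark : forall n a b, a < b -> exists t m, [/\ a < t < b, m <> n &
    forall k, side k n t = m /\ forall t', side k n t' = m -> t' = t];
  law_separate : forall k k' n a b, k <> k' -> a < b -> exists t,
    [/\ a < t < b, side k n t <> n & side k' n t <> side k n t] }.

Context (k0 : K) (side : K -> nat -> R -> nat).
Context (lawP : branching_law side) (two : forall k : K, exists k', k' <> k).
Local Notation node := (node k0 side).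
Implicit Types (x y z v w : node) (s t u : R) (i j : K * nat).

(** The union of a bounded increasing sequence of histories is a history if
class 0 is avoided near its end; avoiding it from some level [a] on suffices. *)
Lemma history_increasing_union (u : nat -> node) (a M : R) :
  (forall n, u n < u n.+1) -> (forall n, a < lev (u n) <= M) ->
  (forall n s, a < s < lev (u n) -> (typ (u n) s).2 <> 0%N) ->
  exists b, forall n, u n <= b.
Proof.
move=> ui uM u0.
have mono m n : (m <= n)%N -> u m <= u n.
  by move=> /subnK <-; elim: (n - m)%N => // p IH; exact: le_trans IH (ltW (ui _)).
have cmp m n s : s < lev (u m) -> s < lev (u n) -> typ (u m) s = typ (u n) s.
  move=> sm sn; have [mn|/ltnW nm] := leqP m n.
    exact: typ_le (mono _ _ mn) sm.
  by symmetry; exact: typ_le (mono _ _ nm) sn.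
pose S := range (fun n => lev (u n)); pose T := sup S.
have nS : S !=set0 by exists (lev (u 0%N)), 0%N.
have bS : has_ubound S by exists M => _ [n _ <-]; case/andP: (uM n).
have levT n : lev (u n) <= T by apply: ub_le_sup => //; exists n.
have near s : s < T -> exists n, s < lev (u n).
  move=> sT; have [|_ [n _ <-] h] := @sup_adherent _ S (T - s) _ (conj nS bS).
    by lra.
  by exists n; rewrite -/T in h; lra.
pose F s := typ (u (xget 0%N [set n | s < lev (u n)])) s.
have Fu n : agree (typ (u n)) F (lev (u n)).
  by move=> s sn; rewrite /F; case: xgetP => [m _ sm|/(_ n)//]; exact: cmp.
have hF : history k0 side T F.
  have T0 : 0 <= T := le_trans (lev_ge0 _) (levT 0%N).
  split=> // s.
  - move=> h; apply: (history_out (nodeP _)); case: h => h; [by left | right].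
    exact: le_trans (levT _) h.
  - move=> /near[n sn]; rewrite -(Fu n) //.
    apply: (allowed_agree (agree_le (ltW sn) (Fu n))).
    exact: (history_allowed (nodeP _)).
  - move=> /near[n sn]; have [e se he] := history_right (nodeP (u n)) sn.
    exists (Num.min e (lev (u n))); rewrite ?lt_min ?se // => v.
    by move=> /andP[sv]; rewrite lt_min => /andP[ve vn] _; rewrite -!(Fu n) // he ?sv.
  - rewrite le_eqVlt => /predU1P[->|/near[n sn]].
      right; exists a.
        by have /andP[an _] := uM 0%N; exact: lt_le_trans an (levT _).
      move=> v /andP[av /near[n vn]]; rewrite -(Fu n) //.
      by apply: u0; rewrite av.
    have [[i b]|[e es he]] := history_left (nodeP (u n)) (ltW sn).
      by left; exists i; exact: before_agree (agree_le (ltW sn) (Fu n)) b.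
    right; exists e => // v /andP[ev vs].
    by rewrite -(Fu n) ?(lt_trans vs) //; apply: he; rewrite ev.
by exists (Node hF) => n; apply/le_nodeP; split; [exact: levT | exact: Fu].
Qed.

(** The witness keeps below a fixed level and avoids class 0 from [lev x] on. On
a stem of positive class, it misses a component only where class 0 branches off,
and [law_zero_rare] enumerates the levels where this happens. *)
Lemma tame_of_class_pos x y : x < y -> (dir x y).2 <> 0%N -> tame x y.
Proof.
move=> xy xy0.
exists [set z | [/\ x < z, lev z < lev y + 1 &
  forall s, lev x <= s < lev z -> (typ z s).2 <> 0%N]].
split=> [|w v xw wv [xv vy v0]|z v xz zv [xv vy v0]|u Uu ui].
- have [y' [xy' y'y st]] := stem_ex xy; exists y'; first by rewrite xy'.
  split=> // [|s xs]; first by have := lev_le y'y; lra.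
  by rewrite st // (dir_le xy' y'y).
- have l := lev_le wv; split=> // [|s /andP[xs sw]]; first by lra.
  by rewrite (typ_le wv sw); apply: v0; rewrite xs; lra.
- have [v' [zv' v'v st]] := stem_ex zv; exists v'; first by rewrite zv'.
  have d0 : (dir z v').2 <> 0%N.
    by rewrite (dir_le zv' v'v); apply: v0; rewrite (lev_lt zv) lev_le.
  have [e he] := law_zero_rare lawP (dir z v').1 d0.
  exists (fun m => restr v' (e m)) => w /andP[zw wv'] [v2 wv2 miss].
  suff /he[m em] : side (dir z v').1 (dir z v').2 (lev w) = 0%N.
    by exists m; rewrite -em restr_lev // ltW.
  apply: contrapT => side0; have b := stem_before st zw (ltW wv').
  have dw0 : (dir w v2).2 <> 0%N by have [->|[_ ->]] := dir_options b wv2.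
  have [v3 [wv3 v32 st3]] := stem_ex wv2.
  have wv := lt_le_trans wv' v'v.
  have [[l1 l2] l3] := (lev_lt wv3, lev_lt wv, lev_le xz).
  pose t := Num.min (lev v3) ((lev w + (lev y + 1)) / 2).
  have [||wt tv3 lt] := @restr_between _ _ _ _ w v3 t; first exact: ltW.
    by rewrite ge_min lexx lt_min l1 /=; lra.
  apply: (miss (restr v3 t)); first by rewrite wt (le_trans tv3).
  split=> [||s]; first exact: le_lt_trans xz (lt_trans zw wt).
    by rewrite lt gt_min; apply/orP; right; lra.
  rewrite lt => /andP[xs st'].
  have [sw|ws] := ltP s (lev w).
    rewrite -(typ_le (ltW wt)) // (typ_le (ltW wv)) //.
    by apply: v0; rewrite xs; lra.
  rewrite (typ_le tv3) ?lt // st3 ?ws ?(lt_le_trans st') ?ge_min ?lexx //.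
  by rewrite (dir_le wv3 v32).
- apply: (@history_increasing_union u (lev x) (lev y + 1)) => // n.
    by have [xu uy _] := Uu n; rewrite lev_lt // ltW.
  by have [_ _ h] := Uu n => s /andP[/ltW xs sn]; apply: h; rewrite xs.
Qed.

(** In any witness [U] one can climb forever: the component entered last has
class 0, so uncountably many points of its stem let class 0 branch off, and at
one of them [U] contains the start of that branch. An upper bound of the
resulting sequence would change its label and have class 0 arbitrarily close to
the left of the supremum of the levels. *)
Lemma not_tame_of_class_zero x y : x < y -> (dir x y).2 = 0%N -> ~ tame x y.
Proof.
move=> xy xy0 [U [[y' /andP[xy' y'y] Uy'] down most bound]].
(* A state is a point together with a class 0 component above it entered by [U]. *)
pose state (p : node * node) :=
  [/\ x <= p.1, p.1 < p.2, U p.2 & (dir p.1 p.2).2 = 0%N].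
have step p : state p -> exists q,
    [/\ state q, p.1 < q.1, q.1 < p.2 & (dir q.1 q.2).1 <> (dir p.1 p.2).1].
  case: p => z v [/= xz zv Uv zv0].
  have [v1 /andP[zv1 v1v] [e he]] := most _ _ xz zv Uv.
  have [v2 [zv2 v21 st]] := stem_ex zv1.
  have [t [tI te t0]] :=
    law_zero_often lawP (dir z v2).1 (fun n => lev (e n)) (lev_lt zv2).
  have v2v := le_trans v21 v1v.
  have /andP[t1 t2] := tI.
  have [||zw wv2 lw] := @restr_between _ _ _ _ z v2 t; first exact: ltW.
    by rewrite t1 ltW.
  set w := restr v2 t in zw wv2 lw.
  have wv2' : w < v2 by apply: lt_lev; rewrite ?lw.
  have nm : ~ misses U w.
    move=> /he[|n we]; first by rewrite zw (lt_le_trans wv2').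
    by apply: (te n); rewrite -lw we.
  have b := stem_before st zw wv2.
  have [k kne] := two (dir z v2).1.
  have [w1 ww1 dw1] := side_ex b kne.
  have [w' /andP[ww' w'1] Uw'] : exists2 w', w < w' <= w1 & U w'.
    apply: contrapT => h; apply: nm; exists w1 => // w' hw' Uw'.
    by apply: h; exists w'.
  have dz : dir z v2 = dir z v by exact: dir_le.
  have dw : dir w w' = (k, 0%N).
    rewrite (dir_le ww' w'1) dw1 lw dz zv0 -dz; congr pair; exact: t0.
  exists (w, w'); split=> //=.
  - by split; rewrite ?dw //=; exact: le_trans xz (ltW zw).
  - exact: lt_le_trans wv2' v2v.
  - by rewrite dw -dz.
pose st := {p : node * node | state p}.
have [nxt hn] : {nxt : st -> st & forall p : st,
    [/\ (sval p).1 < (sval (nxt p)).1, (sval (nxt p)).1 < (sval p).2 &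
     (dir (sval (nxt p)).1 (sval (nxt p)).2).1 <> (dir (sval p).1 (sval p).2).1]}.
  apply: (@choice _ _ (fun p q : st => [/\ (sval p).1 < (sval q).1,
    (sval q).1 < (sval p).2 &
    (dir (sval q).1 (sval q).2).1 <> (dir (sval p).1 (sval p).2).1])).
  by case=> p hp; have [q [hq h1 h2 h3]] := step p hp; exists (exist _ q hq).
have s0 : state (x, y') by split; rewrite //= (dir_le xy' y'y).
pose p n := iter n nxt (exist _ _ s0).
pose z n := (sval (p n)).1; pose v n := (sval (p n)).2.
have sp n : state (z n, v n) by rewrite -surjective_pairing; exact: (svalP (p n)).
have hp n : [/\ z n < z n.+1, z n.+1 < v n &
    (dir (z n.+1) (v n.+1)).1 <> (dir (z n) (v n)).1] := hn (p n).
have [||b hb] := bound (fun n => z n.+1).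
- move=> n; have [z1 z2 _] := hp n; have [xz _ Uv _] := sp n.
  by apply: (down _ (v n)); [exact: le_lt_trans xz z1 | exact: ltW | ].
- by move=> n; have [] := hp n.+1.
have typb n : typ b (lev (z n.+1)) = dir (z n.+1) (v n.+1).
  have [z1 z2 _] := hp n.+1.
  by rewrite -(typ_le (hb n.+1)) ?(lev_lt z1) // (typ_le (ltW z2)) ?(lev_lt z1).
pose S := range (fun n => lev (z n.+1)); pose T := sup S.
have nS : S !=set0 by exists (lev (z 1%N)), 0%N.
have ubb : ubound S (lev b) by move=> _ [n _ <-]; exact: lev_le.
have bS : has_ubound S by exists (lev b).
have levT n : lev (z n.+1) < T.
  have [z1 _ _] := hp n.+1; apply: (lt_le_trans (lev_lt z1)).
  by apply: ub_le_sup => //; exists n.+1.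
have near s : s < T -> exists n, s < lev (z n.+1).
  move=> sT; have [|_ [n _ <-] h] := @sup_adherent _ S (T - s) _ (conj nS bS).
    by lra.
  by exists n; rewrite -/T in h; lra.
(* Consecutive points of the sequence give different labels of class 0 to [b]. *)
have [[i [e eT he]]|[e eT he]] := history_left (nodeP b) (ge_sup nS ubb);
    have [n en] := near _ eT.
  have [z1 _ ne] := hp n.+1.
  have en' := lt_trans en (lev_lt z1).
  by apply: ne; rewrite -!typb !he ?en ?en' /=.
apply: (he (lev (z n.+1))); first by rewrite en levT.
by rewrite typb; have [] := sp n.+1.
Qed.


Lemma stem_side_class x y w v : stem x y -> x < w -> w <= y -> w < v ->
  ((dir x y).2.-1 <= (dir w v).2)%N.
Proof.
move=> st xw wy wv.
by have [->|[_ ->]] := dir_options (stem_before st xw wy) wv;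
  [exact: leq_pred | exact: law_ge].
Qed.

Lemma ex_side_class_pred x y : x < y ->
  exists w v, [/\ x < w, w < y, w < v & (dir w v).2 = (dir x y).2.-1].
Proof.
move=> xy; have [y1 [xy1 y1y st]] := stem_ex xy.
have [t /andP[t1 t2] ht] := law_pred lawP (dir x y1).1 (dir x y1).2 (lev_lt xy1).
have [||xw wy1 lw] := @restr_between _ _ _ _ x y1 t; first exact: ltW.
  by rewrite t1 ltW.
have [k kne] := two (dir x y1).1.
have [v wv dv] := side_ex (stem_before st xw wy1) kne.
exists (restr y1 t), v; split=> //; last by rewrite dv lw /= ht (dir_le xy1 y1y).
by apply: (lt_le_trans _ y1y); apply: lt_lev; rewrite ?lw.
Qed.

(** Induction on the class [n] of the component above [x]; the image class [n']
is not smaller, by induction applied to the inverse. Class 0 is detected by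
tameness. For [n > 0], class [n - 1] branches off arbitrarily close to [x],
hence close to [f x], where only classes at least [n' - 1] branch off. *)
Lemma class_automorphism f g x y : inverse_automorphisms f g -> x < y ->
  (dir (f x) (f y)).2 = (dir x y).2.
Proof.
suff H n : forall f g x y, inverse_automorphisms f g -> x < y ->
    (dir x y).2 = n -> (dir (f x) (f y)).2 = n by move=> a xy; exact: H a xy _.
elim/ltn_ind: n => n IH {}f {}g {}x {}y a xy dn.
have a' := inverse_automorphisms_sym a.
have [fg gf _ _] := a; have flt := automorphism_lt a.
have fxy : f x < f y by rewrite flt.
have [n'n|nn'|-> //] := ltngtP (dir (f x) (f y)).2 n.
  have := IH _ n'n g f _ _ a' fxy erefl.
  by rewrite !fg dn.
have [n0|n0] := eqVneq n 0%N.
  exfalso; apply: (@not_tame_of_class_zero x y xy); first by rewrite dn.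
  rewrite -(fg x) -(fg y); apply: (tame_automorphism a').
  by apply: tame_of_class_pos => //; lia.
have [y1 [xy1 y1y st]] := stem_ex fxy.
have xgy1 : x < g y1 by rewrite -flt gf.
have gy1y : g y1 <= y by rewrite -(automorphism_le a) gf.
have [w [v [xw wy1 wv dwv]]] := ex_side_class_pred xgy1.
have fwy1 : f w < y1 by rewrite -(gf y1) flt.
have n1 : (n.-1 < n)%N by lia.
have fwv : f w < f v by rewrite flt.
have xw' : f x < f w by rewrite flt.
have e : (dir (f w) (f v)).2 = n.-1.
  by apply: (IH _ n1 f g w v a wv); rewrite dwv (dir_le xgy1 gy1y) dn.
have := stem_side_class st xw' (ltW fwy1) fwv.
by rewrite e (dir_le xy1 y1y); lia.
Qed.

(** * Rigidity *)

(** The point [y2] is chosen so low that both the segment above [x] and its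
image are stems, of the same class [n]. Marked levels are preserved since the
class branching off at them determines them; the marked levels being dense, all
levels are preserved. If the image stem belonged to a different [k'], the
classes branching off at some level of both stems would differ. *)
Lemma automorphism_fixes_stem f g x y : inverse_automorphisms f g -> f x = x ->
  x < y -> exists y', [/\ x < y', y' <= y & forall w, x < w -> w < y' -> f w = w].
Proof.
move=> a fx xy; have a' := inverse_automorphisms_sym a.
have [fg gf _ _] := a; have [fle flt] := (automorphism_le a, automorphism_lt a).
have xfy : x < f y by rewrite -fx flt.
have [y1 [xy1 y1y st1]] := stem_ex xy.
have [z1 [xz1 z1y stz]] := stem_ex xfy.
have xgz : x < g z1 by rewrite -flt gf fx.
have gzy : g z1 <= y by rewrite -fle gf.
have [y2 [xy2 y2y1 y2z]] : exists y2, [/\ x < y2, y2 <= y1 & y2 <= g z1].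
  have [h|/ltW h] := leP (lev y1) (lev (g z1)).
    by exists y1; split=> //; exact: le_below y1y gzy h.
  by exists (g z1); split=> //; exact: le_below gzy y1y h.
have fz w : w < y2 -> f w < z1.
  by move=> wy2; rewrite -(gf z1) flt; exact: lt_le_trans wy2 y2z.
have fx' w : x < w -> x < f w by rewrite -{2}fx flt.
have b w : x < w -> w < y2 -> before (typ w) (lev w) (dir x y).
  move=> xw wy2; rewrite -(dir_le xy1 y1y).
  exact: stem_before st1 xw (le_trans (ltW wy2) y2y1).
have b' w : x < w -> w < y2 -> before (typ (f w)) (lev (f w)) (dir x (f y)).
  move=> xw wy2; rewrite -(dir_le xz1 z1y).
  exact: stem_before stz (fx' _ xw) (ltW (fz _ wy2)).
have cl : (dir x (f y)).2 = (dir x y).2.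
  by rewrite -{1}fx; exact: class_automorphism a xy.
set n := (dir x y).2 in cl *; set k := (dir x y).1; set k' := (dir x (f y)).1.
have image w m : x < w -> w < y2 -> side k n (lev w) = m -> m <> n ->
    side k' n (lev (f w)) = m.
  move=> xw wy2 sm mn; have [k2 kne] := two k.
  have [v wv dv] := side_ex (b w xw wy2) kne.
  have fwv : f w < f v by rewrite flt.
  have dfv : (dir (f w) (f v)).2 = m by rewrite (class_automorphism a wv) dv.
  have [e|[_ e]] := dir_options (b' w xw wy2) fwv.
    by case: mn; rewrite -dfv e cl.
  by rewrite -dfv e cl.
have at_level t : lev x < t -> t < lev y2 -> exists w, [/\ x < w, w < y2 & lev w = t].
  move=> t1 t2; have [||xw wy lw] := @restr_between _ _ _ _ x y2 t; first exact: ltW.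
    by rewrite t1 ltW.
  by exists (restr y2 t); split=> //; apply: lt_lev; rewrite ?lw.
have marks p q : lev x <= p -> p < q -> q <= lev y2 ->
    exists w, [/\ x < w, w < y2, p < lev w < q & lev (f w) = lev w].
  move=> xp pq qy; have [t [m [/andP[pt tq] mn ht]]] := law_mark lawP n pq.
  have [||w [xw wy2 lw]] := at_level t; [lra | lra |].
  exists w; split=> //; first by rewrite lw pt.
  have [km _] := ht k; have [_ k'm] := ht k'.
  by rewrite [RHS]lw; apply: k'm; apply: image; rewrite ?lw.
have same_level w : x < w -> w < y2 -> lev (f w) = lev w.
  move=> xw wy2; have lfw := lev_lt (fx' _ xw).
  have [l1 l2] := (lev_lt xw, lev_lt wy2).
  have [h|h|//] := ltgtP (lev (f w)) (lev w); exfalso.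
    have [v [xv vy2 /andP[v1 v2] lv]] := marks _ _ (ltW lfw) h (ltW l2).
    have vw : v < w by exact: lt_below (ltW vy2) (ltW wy2) v2.
    by have : lev (f v) < lev (f w) by [apply: lev_lt; rewrite flt]; lra.
  have hm : lev w < Num.min (lev (f w)) (lev y2) by rewrite lt_min h.
  have my : Num.min (lev (f w)) (lev y2) <= lev y2 by rewrite ge_min lexx orbT.
  have [v [xv vy2 /andP[v1 v2] lv]] := marks _ _ (ltW l1) hm my.
  have wv : w < v by exact: lt_below (ltW wy2) (ltW vy2) v1.
  move: v2; rewrite lt_min => /andP[v2 _].
  by have : lev (f w) < lev (f v) by [apply: lev_lt; rewrite flt]; lra.
have kk' : k = k'.
  apply: contrapT => kk'.
  have [t [/andP[t1 t2] h1 h2]] := law_separate lawP n kk' (lev_lt xy2).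
  have [w [xw wy2 lw]] := at_level t t1 t2.
  by apply: h2; rewrite -lw -{1}(same_level w xw wy2); apply: image; rewrite ?lw.
exists y2; split=> // [|w xw wy2]; first exact: le_trans y1y.
apply: node_inj; rewrite same_level // => s sw.
have [sx|xs] := ltP s (lev x).
  by rewrite -(typ_le (ltW (fx' _ xw))) // -(typ_le (ltW xw)).
have wy1 := le_trans (ltW wy2) y2y1; have fwz := ltW (fz _ wy2).
rewrite (typ_le fwz) ?same_level // stz; last first.
  by rewrite xs (lt_le_trans sw) // -same_level // lev_le.
rewrite (typ_le wy1) // st1; last by rewrite xs (lt_le_trans sw) // lev_le.
rewrite (dir_le xy1 y1y) (dir_le xz1 z1y).
by rewrite [LHS]surjective_pairing [RHS]surjective_pairing -/k -/k' kk' cl.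
Qed.

(** Points are suprema of the points below them; for the root this says that it
is the least element. *)
Lemma le_of_lower_set x h : (forall z, z < x -> z <= h) -> x <= h.
Proof.
move=> zh; have mid s : 0 <= s < lev x -> exists2 z, z < x & lev z = s.
  move=> /andP[s0 sx]; have e : lev (restr x s) = s by rewrite lev_restr // s0 ltW.
  by exists (restr x s) => //; apply: lt_lev; rewrite ?e // restr_le.
have [h0 x0] := (lev_ge0 h, lev_ge0 x).
apply/le_nodeP; split=> [|s sx].
  rewrite leNgt; apply/negP => hx.
  have [|z zx ez] := mid ((lev h + lev x) / 2); first by lra.
  by have := lev_le (zh _ zx); lra.
have [s0|s0] := ltP s 0; first by rewrite !(history_out (nodeP _)) //; left.
have [|z zx ez] := mid ((s + lev x) / 2); first by lra.
have sz : s < lev z by lra.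
by rewrite -(typ_le (ltW zx)) // (typ_le (zh _ zx)).
Qed.

Lemma rigid_nodes : rigid node.
Proof.
move=> f [g [fg gf hf hg]] y.
have a : inverse_automorphisms f g by [].
have [fle flt] := (automorphism_le a, automorphism_lt a).
have fix_sup x : (forall z, z < x -> f z = z) -> f x = x.
  move=> h; apply/eqP; rewrite eq_le; apply/andP; split.
    rewrite -{2}(gf x) fle; apply: le_of_lower_set => z zx.
    by rewrite -fle gf h // ltW.
  by apply: le_of_lower_set => z zx; rewrite -(h z) // fle ltW.
pose S := [set s | 0 <= s <= lev y /\ forall x, x <= y -> lev x <= s -> f x = x].
have S0 : S 0.
  split=> [|x xy x0]; first by rewrite lexx lev_ge0.
  by apply: fix_sup => z zx; exfalso; have := lev_lt zx; have := lev_ge0 z; lra.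
have nS : S !=set0 by exists 0.
have uS : ubound S (lev y) by move=> s [/andP[]].
have bS : has_ubound S by exists (lev y).
pose m := sup S; have m0 : 0 <= m by exact: ub_le_sup.
have my : m <= lev y by exact: ge_sup.
have below x : x <= y -> lev x < m -> f x = x.
  move=> xy xm; have [|s [_ h] sm] := @sup_adherent _ S (m - lev x) _ (conj nS bS).
    by lra.
  by apply: h => //; rewrite -/m in sm; lra.
have upto x : x <= y -> lev x <= m -> f x = x.
  move=> xy xm; apply: fix_sup => z zx; apply: below; first exact: le_trans (ltW zx) xy.
  exact: lt_le_trans (lev_lt zx) xm.
have [ym|my'] := leP (lev y) m; first exact: upto.
exfalso; set x := restr y m.
have lx : lev x = m by rewrite lev_restr // m0.
have xy : x < y by apply: lt_lev; rewrite ?lx // restr_le.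
have [|y' [xy' y'y fixed]] := automorphism_fixes_stem a _ xy.
  by apply: upto; rewrite ?lx // ltW.
have [l1 l2] := (lev_lt xy', lev_le y'y); rewrite lx in l1.
suff : S ((m + lev y') / 2) by move=> /(ub_le_sup bS); rewrite -/m; lra.
split=> [|z zy zl]; first lra.
have [zm|mz] := leP (lev z) m; first exact: upto.
apply: fixed; first by apply: (lt_below (ltW xy) zy); rewrite lx.
by apply: (lt_below zy y'y); lra.
Qed.

End Rigidity.

(** * A branching law *)

Section LawExistence.
Context (R : realType) (K : Type) (chi : K -> R -> Prop) (s0 : R).
Context (chi_sep : separating chi) (s0_irr : forall r : rat, s0 <> ratr r).
Context (two : forall k : K, exists k', k' <> k).
Local Open Scope ring_scope.

Definition rational_index (t : R) : option nat :=
  if `[< exists r : rat, t = ratr r >]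
  then Some (pickle (xget 0 [set r : rat | t = ratr r])) else None.

Lemma rational_index_ratr (r : rat) : rational_index (ratr r) = Some (pickle r).
Proof.
rewrite /rational_index asboolT; last by exists r.
have /fmorph_inj <- // :
    ratr r = ratr (xget 0 [set r' : rat | ratr r = ratr r' :> R]) :> R.
exact: (@xgetI rat 0 [set r' : rat | ratr r = ratr r' :> R] r erefl).
Qed.

Lemma rational_indexP t m : rational_index t = Some m ->
  exists2 r : rat, t = ratr r & m = pickle r.
Proof.
rewrite /rational_index; case: asboolP => // -[r ->]; exists r => //.
have := rational_index_ratr r; rewrite /rational_index asboolT; last by exists r.
by congruence.
Qed.

(** Two disjoint countable dense sets of levels have special roles: the
rationals are marked by classes that occur nowhere else on the stems of class
[n], and their translates by the irrational [s0] let the class drop. Since the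
marks are above [n], they never interfere with the drop. *)
Definition side_rule (k : K) (n : nat) (t : R) : nat :=
  if rational_index t is Some m then (n + m).+2
  else if rational_index (t - s0) is Some _ then n.-1
  else if `[< chi k t >] then n.+1 else n.

(** An enumeration of the given sequence and of all special levels. *)
Definition avoiding (e : nat -> R) (n : nat) : R :=
  match unpickle n : option (nat + (rat + rat)) with
  | Some (inl m) => e m
  | Some (inr (inl r)) => ratr r
  | Some (inr (inr r)) => s0 + ratr r
  | None => 0
  end.

Lemma side_rule_separate k k' (e : nat -> R) a b : k <> k' -> a < b ->
  exists t, [/\ a < t < b, forall m, t <> e m &
    forall n, side_rule k n t = n.+1 /\ side_rule k' n t = n].
Proof.
move=> kk' ab; have [t [tab te ck ck']] := chi_sep kk' (avoiding e) ab.
exists t; split=> // [m tm|n].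
  by apply: (te (pickle (inl m : nat + (rat + rat)))); rewrite /avoiding pickleK.
have t1 : rational_index t = None.
  case E : rational_index => [m|] //; have [r tr _] := rational_indexP E.
  by case: (te (pickle (inr (inl r) : nat + (rat + rat)))); rewrite /avoiding pickleK.
have t2 : rational_index (t - s0) = None.
  case E : rational_index => [m|] //; have [r tr _] := rational_indexP E.
  case: (te (pickle (inr (inr r) : nat + (rat + rat)))); rewrite /avoiding pickleK -tr.
  by ring.
by rewrite /side_rule t1 t2 asboolT // asboolF.
Qed.

Lemma branching_law_side_rule : branching_law side_rule.
Proof.
split.
- move=> k n t; rewrite /side_rule; case: rational_index => [m|]; first by lia.
  by case: rational_index => // ; case: asboolP; lia.
- move=> k n n0.
  exists (fun m => if unpickle m is Some r then s0 + ratr r else 0) => t.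
  rewrite /side_rule; case: rational_index => [m|] //.
  case E : rational_index => [m|]; last by case: asboolP.
  have [r tr _] := rational_indexP E.
  by exists (pickle r); rewrite pickleK -tr; ring.
- move=> k a b e ab; have [k' kk'] := two k.
  have [t [tab te h]] := side_rule_separate e kk' ab.
  by exists t; split=> //; case: (h 0%N).
- move=> k n a b ab.
  have [|r] := @rat_in_itvoo R (a - s0) (b - s0); first by lra.
  rewrite in_itv /= => /andP[ar rb].
  exists (s0 + ratr r); first by apply/andP; split; lra.
  have e : s0 + ratr r - s0 = ratr r by ring.
  rewrite /side_rule e rational_index_ratr.
  case E : rational_index => [m|] //; have [r' h _] := rational_indexP E.
  by case: (@s0_irr (r' - r)); rewrite raddfB /= -h; ring.
- move=> n a b /rat_in_itvoo[r]; rewrite in_itv /= => rab.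
  exists (ratr r), (n + pickle r).+2; split=> //; first by lia.
  move=> k; rewrite {1}/side_rule rational_index_ratr; split=> // t.
  rewrite /side_rule; case E : rational_index => [m|].
    by have [r' -> ->] := rational_indexP E => -[/addnI/(pcan_inj pickleK) ->].
  by case: rational_index => [m|]; [lia | case: asboolP; lia].
- move=> k k' n a b kk' ab.
  have [t [tab _ /(_ n)[h1 h2]]] := side_rule_separate (fun=> 0) kk' ab.
  by exists t; rewrite h1 h2; split=> //; lia.
Qed.

End LawExistence.

Lemma ex_irrational (R : realType) : exists s : R, forall r : rat, s <> ratr r.
Proof.
have [s [_ _ h]] := even_code_onto set0
  (fun m => if unpickle m is Some r then ratr r else 0%R : R) (@ltr01 R).
by exists s => r sr; apply: (h (pickle r)); rewrite pickleK.
Qed.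

Theorem theorem21 (R : realType) (K Cplus : Type)
    (hCplus : is_succ_card [set: set nat] [set: Cplus])
    (hK2 : [set: 'I_2] #<= [set: K])
    (hKc : [set: K] #<= [set: Cplus]) :
  exists (d : Order.disp_t) (X : porderType d),
    [/\ branchwise_real_tree R X,
        uniformly_branching X K,
        rigid X
      & continuously_gradable R X].
Proof.
have [i2 i2_inj] := inj_of_card_le hK2.
have two (k : K) : exists k', k' <> k.
  have [<-|k1] := pselect (i2 ord0 = k); last by exists (i2 ord0).
  by exists (i2 ord_max) => /i2_inj.
have [phi phi_inj] := inj_of_card_le
  (card_le_trans hKc (succ_card_le_powerset hCplus)).
have [chi chi_sep] := ex_separating R phi_inj.
have [s0 s0_irr] := ex_irrational R.
have lawP := branching_law_side_rule chi_sep s0_irr two.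
exists ring_display, (node (i2 ord0) (side_rule chi s0)); split.
- exact: branchwise_real_nodes.
- exact: uniformly_branching_nodes.
- exact: rigid_nodes lawP two.
- exact: continuously_gradable_nodes.
Qed.
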